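(* $$\sum_{k=0}^{\infty}\frac{\binom{2k}{k}^4\binom{3k}{k}}{2^{12k}}\Big\{(74k^2+27k+3)H_{2k}-17k-3\Big\}=0.$$
   Context: For a nonnegative integer $n$, $H_n=\sum_{j=1}^{n}\frac{1}{j}$ denotes the classical harmonic number, with $H_0=0$. *)

(* Defs.v *)
From Stdlib Require Import Reals.
From Coquelicot Require Import Coquelicot.

Open Scope R_scope.

(* [sum_n_m a 1 0] is the empty sum, so [harmonic 0 = 0]. *)
Definition harmonic (n : nat) : R := sum_n_m (fun j : nat => / INR j) 1 n.

(* Coquelicot's [C] (the complex numbers) shadows the binomial coefficient
   [Binomial.C] of the standard library. *)
Definition binom (n k : nat) : R := Binomial.C n k.

(* Main.v *)
Require Import Defs.
From Stdlib Require Import Reals Lra Lia Arith.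
From Coquelicot Require Import Coquelicot.

Open Scope R_scope.

(** The series is the derivative in a parameter of a summation that the
Wilf-Zeilberger method transports from row to row of a two-dimensional array.

Write $(a)_m$ for the rising factorial and put
$$w_x(n,k) = \frac{(k+3n)!\,(1/2+x)_{k+n}^2\,(1/2+2x)_{k+n}\,(1/2)_n\,
(1/2-x)_n^2}{(1/2+2x)_k\, n!\,(1-x)_n^2\,(1+x)_{k+2n}^2\,(k+2n)!}.$$
Up to constant factors,
$F_x = 16\, w_x\, n (n-x)^2 (2k+3n+1/2+2x) / ((k+3n)(k+1/2+2x))$
is the summand of Dougall's 5F4 series with parameters $a = e = 1/2+2x$,
$b \to 0$ and $c = d = 1/2+x$, where $n$ counts shifts of $(a;b,c,d,e)$ by
$(3;3,1,1,1)$. It therefore has a partner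
$G_x = w_x N_x / ((k+3n)(k+2n+1)(k+2n+1+x)^2)$, with $N_x$ a polynomial in
$n$, $k$ and $x$, such that
$$G_x(n,k+1) - G_x(n,k) = F_x(n,k) - F_x(n+1,k).$$
Differentiating this at $x = 0$ gives a pair [dF], [dG] of the same kind, in
which harmonic numbers enter through the logarithmic derivative of $w_x$
([dlog_weight]). In the row $k = 0$, for $n > 0$, [dG] is $2/3$ of the summand of the
theorem ([dG_row_0]), and this is why the shifts and the dependence on $x$ are chosen
as above.

Since $F_x(0,k)$ has the factor $n = 0$, and [dF] decays geometrically in $n$,
the sum over $n$ of [dG] is the same in all rows. It remains to see that the
row sums tend to $0$ as $k$ grows. The undifferentiated rows, which are
positive, have bounded sums, because $F_0 \ge 0$ makes these sums decrease with
$k$. So one needs that the factor [dG] / [G] is small where the mass of the row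
lies. This factor is at most a constant times
$$\frac{1}{n+1} + \frac{1}{k+1} + \frac{n^2}{(k+1)(k+n+1)}$$
([dlog_weight_bound], [dGrat_bound]). The mass of row $k$ sits around
$n \approx k^{2/3}$, where all three terms are small: the initial terms of a
row are $O(1/k)$ ([weight_first_le], [mass_div_le]), and the decrease of the
weight in $n$ by the factor $1 - n^2/((k+2n+1)(k+2n+2))$ makes a weighted sum
telescope and controls the last term ([sum_mass_telescope]). The resulting
bound [row_sum_small] holds uniformly for all partial row sums, so that
convergence of the series comes out together with its value. *)

(** * Half-integer Pochhammer symbols and harmonic numbers *)

Fixpoint half_poch (m : nat) : R :=
  match m with O => 1 | S m => half_poch m * (INR m + / 2) end.
Fixpoint half_harmonic (m : nat) : R :=
  match m with O => 0 | S m => half_harmonic m + / (INR m + / 2) end.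

Lemma half_poch_pos m : 0 < half_poch m.
Proof.
  induction m as [|m IH]; simpl; [lra|].
  pose proof (pos_INR m); apply Rmult_lt_0_compat; lra.
Qed.

Lemma fact_double m : INR (fact (2 * m)) = 4 ^ m * half_poch m * INR (fact m).
Proof.
  induction m as [|m IH]; [simpl; lra|].
  replace (2 * S m)%nat with (S (S (2 * m))) by lia.
  rewrite !fact_simpl, !mult_INR, IH, !S_INR, mult_INR.
  simpl. field.
Qed.

Lemma harmonic_0 : harmonic 0 = 0.
Proof. unfold harmonic. rewrite sum_n_m_zero; [reflexivity|lia]. Qed.

Lemma harmonic_S m : harmonic (S m) = harmonic m + / (INR m + 1).
Proof. unfold harmonic. rewrite sum_n_Sm, S_INR by lia. reflexivity. Qed.

Lemma harmonic_double m : 2 * harmonic (2 * m) = harmonic m + half_harmonic m.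
Proof.
  induction m as [|m IH]; [simpl; rewrite harmonic_0; lra|].
  replace (2 * S m)%nat with (S (S (2 * m))) by lia.
  rewrite !harmonic_S, !Rmult_plus_distr_l, IH, !S_INR, mult_INR; simpl.
  pose proof (pos_INR m). field. repeat split; lra.
Qed.

(** * The weight and its logarithmic derivative *)

(** $w_0(n,k)$; see the introduction for $w_x$. *)
Definition weight (n k : nat) : R :=
  INR (fact (k + 3 * n)) * half_poch (k + n) ^ 3 * half_poch n ^ 3 /
  (half_poch k * INR (fact n) ^ 3 * INR (fact (k + 2 * n)) ^ 3).

(** $\partial_x \log w_x(n,k)$ at $x = 0$: a factor $(1/2+cx)_m$ contributes
[c * half_harmonic m], and a factor $(1+cx)_m$ contributes [c * harmonic m]. *)
Definition dlog_weight (n k : nat) : R :=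
  4 * half_harmonic (k + n) - 2 * half_harmonic n - 2 * half_harmonic k
  + 2 * harmonic n - 2 * harmonic (k + 2 * n).

(** In the rational functions below, [x] and [y] stand for the indices $n$ and
$k$; the parameter of deformation no longer appears. *)
Definition ratio_k (x y : R) : R :=
  (y + 3 * x + 1) * (y + x + / 2) ^ 3 / ((y + / 2) * (y + 2 * x + 1) ^ 3).
Definition ratio_n (x y : R) : R :=
  (y + 3 * x + 1) * (y + 3 * x + 2) * (y + 3 * x + 3) * (y + x + / 2) ^ 3
  * (x + / 2) ^ 3 / ((x + 1) ^ 3 * (y + 2 * x + 1) ^ 3 * (y + 2 * x + 2) ^ 3).
Definition dlog_k (x y : R) : R :=
  4 / (y + x + / 2) - 2 / (y + / 2) - 2 / (y + 2 * x + 1).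
Definition dlog_n (x y : R) : R :=
  4 / (y + x + / 2) - 2 / (x + / 2) + 2 / (x + 1)
  - 2 / (y + 2 * x + 1) - 2 / (y + 2 * x + 2).

Lemma weight_pos n k : 0 < weight n k.
Proof.
  unfold weight.
  pose proof (half_poch_pos (k + n)); pose proof (half_poch_pos n);
  pose proof (half_poch_pos k);
  pose proof (INR_fact_lt_0 n); pose proof (INR_fact_lt_0 (k + 2 * n));
  pose proof (INR_fact_lt_0 (k + 3 * n)).
  apply Rdiv_lt_0_compat; repeat apply Rmult_lt_0_compat;
    auto using pow_lt, Rlt_0_1.
Qed.

Lemma weight_S_k n k :
  weight n (S k) = weight n k * ratio_k (INR n) (INR k).
Proof.
  unfold weight, ratio_k.
  replace (S k + 3 * n)%nat with (S (k + 3 * n)) by lia.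
  replace (S k + 2 * n)%nat with (S (k + 2 * n)) by lia.
  rewrite !fact_simpl, !mult_INR, !S_INR; simpl half_poch.
  rewrite !plus_INR, !mult_INR.
  replace (INR 3) with 3 by (simpl; lra). replace (INR 2) with 2 by reflexivity.
  pose proof (pos_INR n); pose proof (pos_INR k).
  pose proof (half_poch_pos k); pose proof (INR_fact_lt_0 n);
  pose proof (INR_fact_lt_0 (k + 2 * n)).
  field. repeat split; lra.
Qed.

Lemma weight_S_n n k :
  weight (S n) k = weight n k * ratio_n (INR n) (INR k).
Proof.
  unfold weight, ratio_n.
  replace (k + 3 * S n)%nat with (S (S (S (k + 3 * n)))) by lia.
  replace (k + 2 * S n)%nat with (S (S (k + 2 * n))) by lia.
  replace (k + S n)%nat with (S (k + n)) by lia.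
  rewrite !fact_simpl, !mult_INR, !S_INR; simpl half_poch.
  rewrite !plus_INR, !mult_INR.
  replace (INR 3) with 3 by (simpl; lra). replace (INR 2) with 2 by reflexivity.
  pose proof (pos_INR n); pose proof (pos_INR k).
  pose proof (half_poch_pos k); pose proof (INR_fact_lt_0 n);
  pose proof (INR_fact_lt_0 (k + 2 * n)).
  field. repeat split; lra.
Qed.

Lemma dlog_weight_S_k n k :
  dlog_weight n (S k) = dlog_weight n k + dlog_k (INR n) (INR k).
Proof.
  unfold dlog_weight, dlog_k.
  replace (S k + 2 * n)%nat with (S (k + 2 * n)) by lia.
  rewrite Nat.add_succ_l, harmonic_S; simpl half_harmonic.
  rewrite !plus_INR, mult_INR.
  replace (INR 2) with 2 by reflexivity.
  pose proof (pos_INR n); pose proof (pos_INR k).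
  field. repeat split; lra.
Qed.

Lemma dlog_weight_S_n n k :
  dlog_weight (S n) k = dlog_weight n k + dlog_n (INR n) (INR k).
Proof.
  unfold dlog_weight, dlog_n.
  replace (k + 2 * S n)%nat with (S (S (k + 2 * n))) by lia.
  replace (k + S n)%nat with (S (k + n)) by lia.
  rewrite !harmonic_S; simpl half_harmonic.
  rewrite !S_INR, !plus_INR, mult_INR.
  replace (INR 2) with 2 by reflexivity.
  pose proof (pos_INR n); pose proof (pos_INR k).
  field. repeat split; lra.
Qed.

(** * The WZ pair and its derivative *)

(** Gosper's algorithm for the
unknown polynomial of the partner of $F$ gives [numer], the value at $0$ of
$N_x$, and [dnumer], its first derivative there. *)
Definition numer (x y : R) : R :=
  (48 * x ^ 2 + 24 * x + 4) * y ^ 4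
  + (384 * x ^ 3 + 312 * x ^ 2 + 84 * x + 8) * y ^ 3
  + (1104 * x ^ 4 + 1264 * x ^ 3 + 504 * x ^ 2 + 84 * x + 5) * y ^ 2
  + (1344 * x ^ 5 + 2016 * x ^ 4 + 1112 * x ^ 3 + 276 * x ^ 2 + 30 * x + 1) * y
  + x * (2 * x + 1) ^ 3 * (74 * x ^ 2 + 27 * x + 3).

Definition dnumer (x y : R) : R :=
  - (64 * x + 16) * y ^ 4
  - (384 * x ^ 2 + 224 * x + 24) * y ^ 3
  - (640 * x ^ 3 + 656 * x ^ 2 + 168 * x + 8) * y ^ 2
  - (64 * x ^ 4 + 320 * x ^ 3 + 208 * x ^ 2 + 32 * x) * y
  + 8 * x ^ 2 * (2 * x + 1) ^ 2 * (10 * x + 1).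

Definition Grat (x y : R) : R :=
  numer x y / ((y + 3 * x) * (y + 2 * x + 1) ^ 3).
Definition dGrat (x y : R) : R :=
  dnumer x y / ((y + 3 * x) * (y + 2 * x + 1) ^ 3)
  - 2 * numer x y / ((y + 3 * x) * (y + 2 * x + 1) ^ 4).
Definition Frat (x y : R) : R :=
  16 * x ^ 3 * (2 * y + 3 * x + / 2) / ((y + 3 * x) * (y + / 2)).
Definition dFrat (x y : R) : R :=
  - 32 * x ^ 2 * (2 * y + 3 * x + / 2) / ((y + 3 * x) * (y + / 2))
  - 32 * x ^ 3 / (y + / 2) ^ 2.

(** The WZ equation divided by the weight: an identity of rational functions. *)
Lemma certificate x y : 0 <= x -> 0 <= y -> 0 < y + 3 * x ->
  ratio_k x y * Grat x (y + 1) - Grat x y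
  = Frat x y - ratio_n x y * Frat (x + 1) y.
Proof.
  intros; unfold ratio_k, ratio_n, Grat, Frat, numer.
  field; repeat split; lra.
Qed.

(** The part free of harmonic numbers in the derivative of the WZ equation. The
harmonic numbers themselves are multiplied by both sides of [certificate]. *)
Lemma certificate_deriv x y : 0 <= x -> 0 <= y -> 0 < y + 3 * x ->
  ratio_k x y * (Grat x (y + 1) * dlog_k x y + dGrat x (y + 1)) - dGrat x y
  = dFrat x y
    - ratio_n x y * (Frat (x + 1) y * dlog_n x y + dFrat (x + 1) y).
Proof.
  intros; unfold ratio_k, ratio_n, dlog_k, dlog_n, Grat, dGrat, Frat, dFrat,
    numer, dnumer.
  field; repeat split; lra.
Qed.

Definition G (n k : nat) : R := weight n k * Grat (INR n) (INR k).
Definition F (n k : nat) : R := weight n k * Frat (INR n) (INR k).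
Definition dG (n k : nat) : R :=
  weight n k * (Grat (INR n) (INR k) * dlog_weight n k + dGrat (INR n) (INR k)).
Definition dF (n k : nat) : R :=
  weight n k * (Frat (INR n) (INR k) * dlog_weight n k + dFrat (INR n) (INR k)).

(** At $n = k = 0$ the denominator [k + 3 * n] vanishes. *)
Lemma WZ_pair n k : (0 < k + n)%nat -> G n (S k) - G n k = F n k - F (S n) k.
Proof.
  intros h. unfold G, F.
  rewrite weight_S_k, weight_S_n, !S_INR, !Rmult_assoc, <- !Rmult_minus_distr_l.
  f_equal. apply certificate; try apply pos_INR.
  apply lt_0_INR in h; rewrite plus_INR in h; pose proof (pos_INR n); lra.
Qed.

Lemma WZ_pair_deriv n k :
  (0 < k + n)%nat -> dG n (S k) - dG n k = dF n k - dF (S n) k.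
Proof.
  intros h. unfold dG, dF.
  rewrite weight_S_k, weight_S_n, dlog_weight_S_k, dlog_weight_S_n, !S_INR.
  set (x := INR n); set (y := INR k); set (l := dlog_weight n k).
  assert (hx : 0 <= x) by apply pos_INR. assert (hy : 0 <= y) by apply pos_INR.
  assert (hxy : 0 < y + 3 * x).
  { apply lt_0_INR in h; rewrite plus_INR in h; fold x y in h; lra. }
  pose proof (certificate x y hx hy hxy) as E0.
  pose proof (certificate_deriv x y hx hy hxy) as E1.
  transitivity (weight n k *
    (l * (ratio_k x y * Grat x (y + 1) - Grat x y)
     + (ratio_k x y * (Grat x (y + 1) * dlog_k x y + dGrat x (y + 1))
        - dGrat x y))); [ring|].
  rewrite E0, E1; ring.
Qed.

Lemma F_0 k : F 0 k = 0.
Proof. unfold F, Frat; simpl INR; unfold Rdiv; ring. Qed.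

Lemma dF_0 k : dF 0 k = 0.
Proof. unfold dF, Frat, dFrat; simpl INR; unfold Rdiv; ring. Qed.

(** * The row of the series *)

Definition summand (k : nat) : R :=
  binom (2 * k) k ^ 4 * binom (3 * k) k / 2 ^ (12 * k) *
  ((74 * INR k ^ 2 + 27 * INR k + 3) * harmonic (2 * k) - 17 * INR k - 3).

Lemma weight_row_0 n :
  weight n 0 = binom (2 * n) n ^ 4 * binom (3 * n) n / 2 ^ (12 * n).
Proof.
  unfold weight, binom, Binomial.C. rewrite !Nat.add_0_l.
  replace (2 * n - n)%nat with n by lia.
  replace (3 * n - n)%nat with (2 * n)%nat by lia.
  rewrite !fact_double.
  replace (2 ^ (12 * n)) with ((4 ^ n) ^ 6)
   by (rewrite <- pow_mult; replace 4 with (2 ^ 2) by lra; rewrite <- pow_mult;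
       f_equal; lia).
  pose proof (half_poch_pos n); pose proof (INR_fact_lt_0 n).
  assert (0 < 4 ^ n) by (apply pow_lt; lra).
  simpl half_poch. field. repeat split; lra.
Qed.

(** The polynomial [numer] specializes at $k = 0$ to a multiple of
$74 n^2 + 27 n + 3$, and [dlog_weight] becomes
$2 H_{2n}$ because the odd harmonic sums combine with $H_n$. *)
Lemma dG_row_0 n : (0 < n)%nat -> dG n 0 = 2 / 3 * summand n.
Proof.
  intros h; apply lt_0_INR in h.
  unfold dG, summand. rewrite <- weight_row_0, Rmult_comm,
    (Rmult_comm (weight n 0)), <- Rmult_assoc.
  f_equal.
  unfold dlog_weight. rewrite !Nat.add_0_l; simpl half_harmonic at 3.
  replace (half_harmonic n) with (2 * harmonic (2 * n) - harmonic n)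
   by (rewrite harmonic_double; ring).
  simpl (INR 0).
  unfold Grat, dGrat, numer, dnumer. field. repeat split; lra.
Qed.

(** The derived WZ equation from row $0$ to row $1$. The entry $n = 0$, where
[dG] itself is a division by zero, is checked by evaluation: the summand is the
right value to put there. *)
Lemma row_0_to_1 n : dG n 1 - 2 / 3 * summand n = dF n 0 - dF (S n) 0.
Proof.
  destruct n as [|n].
  - rewrite dF_0.
    unfold dG, dF, summand, binom, Binomial.C, weight, dlog_weight,
      Grat, dGrat, Frat, dFrat, numer, dnumer.
    simpl; rewrite ?harmonic_S, ?harmonic_0; simpl. field.
  - rewrite <- dG_row_0 by lia. apply WZ_pair_deriv; lia.
Qed.

(** * Size of the logarithmic derivative *)

(** Closes goals [0 <= e] for [e] built by sums, products and powers from
nonnegative terms, in particular for polynomials with positive coefficients. *)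
Ltac nonneg := repeat first
  [ assumption | lra | apply pos_INR | apply Rplus_le_le_0_compat
  | apply Rmult_le_pos | apply pow_le ].

Lemma numer_nonneg x y : 0 <= x -> 0 <= y -> 0 <= numer x y.
Proof. intros; unfold numer. nonneg. Qed.

(** Both [4 * numer] plus and minus [(x + 1) * dnumer] have only positive coefficients. *)
Lemma dnumer_le x y :
  0 <= x -> 0 <= y -> (x + 1) * Rabs (dnumer x y) <= 4 * numer x y.
Proof.
  intros hx hy.
  rewrite <- (Rabs_pos_eq (x + 1)), <- Rabs_mult by lra.
  apply Rabs_le; split; apply Rminus_le_0; unfold numer, dnumer; ring_simplify;
  nonneg.
Qed.

(** The substitution $y = 1 + z$ turns both inequalities into positivity of all
coefficients of a polynomial in $x$ and $z$. *)
Lemma Grat_bounds x y : 0 <= x -> 1 <= y ->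
  (x + 1) ^ 2 <= Grat x y <= 48 * (x + 1) ^ 2.
Proof.
  intros hx hy. unfold Grat.
  assert (hd : 0 < (y + 3 * x) * (y + 2 * x + 1) ^ 3)
    by (apply Rmult_lt_0_compat; [lra|apply pow_lt; lra]).
  replace y with (1 + (y - 1)) in * by ring.
  assert (hz : 0 <= y - 1) by lra. set (z := y - 1) in *; clearbody z.
  split; [apply (Rle_div_r _ _ _ hd)|apply (Rle_div_l _ _ _ hd)];
  apply Rminus_le_0; unfold numer; ring_simplify; nonneg.
Qed.

Lemma dGrat_bound x y : 0 <= x -> 0 <= y -> 0 < y + 3 * x ->
  Rabs (dGrat x y) <= 6 / (x + 1) * Grat x y.
Proof.
  intros hx hy hxy. unfold dGrat, Grat.
  pose proof (numer_nonneg x y hx hy) as hp. pose proof (dnumer_le x y hx hy) as hd.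
  set (D := (y + 3 * x) * (y + 2 * x + 1) ^ 3).
  assert (hD : 0 < D)
    by (apply Rmult_lt_0_compat; [lra|apply pow_lt; lra]).
  replace ((y + 3 * x) * (y + 2 * x + 1) ^ 4) with (D * (y + 2 * x + 1))
    by (unfold D; ring).
  replace (dnumer x y / D - 2 * numer x y / (D * (y + 2 * x + 1)))
    with ((dnumer x y + - (2 * numer x y / (y + 2 * x + 1))) / D)
    by (field; lra).
  unfold Rdiv at 1. rewrite Rabs_mult, (Rabs_pos_eq (/ D))
    by (left; apply Rinv_0_lt_compat, hD).
  replace (6 / (x + 1) * (numer x y / D))
    with ((4 * numer x y / (x + 1) + 2 * numer x y / (x + 1)) * / D)
    by (field; lra).
  apply Rmult_le_compat_r; [left; apply Rinv_0_lt_compat, hD|].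
  eapply Rle_trans; [apply Rabs_triang|]. apply Rplus_le_compat.
  - apply Rle_div_r; lra.
  - rewrite Rabs_Ropp, Rabs_pos_eq
      by (apply Rdiv_le_0_compat; lra).
    apply Rmult_le_compat_l; [lra|]. apply Rinv_le_contravar; lra.
Qed.

(** Converges to $2 \log 2$; only its rate of convergence matters, as the limits
cancel in [dlog_weight]. *)
Definition defect (m : nat) : R := half_harmonic m - harmonic m.

(** The increments of [defect] are dominated by those of $-2/(m+1)$. *)
Lemma defect_increment m p :
  0 <= defect (m + p) - defect m <= 2 / (INR m + 1) - 2 / (INR (m + p) + 1).
Proof.
  induction p as [|p IH]; [rewrite Nat.add_0_r; lra|].
  rewrite Nat.add_succ_r. unfold defect in *.
  rewrite harmonic_S, S_INR; simpl half_harmonic.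
  set (z := INR (m + p)) in *. assert (0 <= z) by apply pos_INR.
  assert (e : 0 <= / (z + / 2) - / (z + 1) <= 2 / (z + 1) - 2 / (z + 1 + 1)).
  { split.
    - apply Rle_minus_r; rewrite Rplus_0_l; apply Rinv_le_contravar; lra.
    - apply Rminus_le_0.
      replace (2 / (z + 1) - 2 / (z + 1 + 1) - (/ (z + / 2) - / (z + 1)))
        with (3 * z / ((2 * z + 1) * (z + 1) * (z + 2))) by (field; lra).
      apply Rdiv_le_0_compat; [lra|]. repeat apply Rmult_lt_0_compat; lra. }
  lra.
Qed.

Lemma defect_close m p : 0 <= defect (m + p) - defect m <= 2 / (INR m + 1).
Proof.
  pose proof (defect_increment m p).
  assert (0 < 2 / (INR (m + p) + 1)); [|lra].
  pose proof (pos_INR (m + p)). apply Rdiv_lt_0_compat; lra.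
Qed.

(** A discrete concavity estimate: both sides are compared through their
increments in [n]. *)
Lemma harmonic_second_difference k n :
  0 <= 2 * harmonic (k + n) - harmonic k - harmonic (k + 2 * n)
    <= INR n ^ 2 / ((INR k + 1) * (INR k + INR n + 1)).
Proof.
  assert (hy : 0 <= INR k) by apply pos_INR.
  induction n as [|n IH].
  - rewrite Nat.mul_0_r, Nat.add_0_r. simpl; unfold Rdiv; lra.
  - replace (k + 2 * S n)%nat with (S (S (k + 2 * n))) by lia.
    rewrite Nat.add_succ_r, !harmonic_S, !S_INR, !plus_INR, mult_INR.
    replace (INR 2) with 2 by reflexivity.
    assert (hx : 0 <= INR n) by apply pos_INR.
    set (x := INR n) in *; set (y := INR k) in *.
    assert (e : 0 <= 2 * / (y + x + 1) - / (y + 2 * x + 1)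
                     - / (y + 2 * x + 1 + 1)
      <= (x + 1) ^ 2 / ((y + 1) * (y + (x + 1) + 1))
         - x ^ 2 / ((y + 1) * (y + x + 1))).
    { split.
      - assert (/ (y + 2 * x + 1) <= / (y + x + 1))
          by (apply Rinv_le_contravar; lra).
        assert (/ (y + 2 * x + 1 + 1) <= / (y + x + 1))
          by (apply Rinv_le_contravar; lra).
        lra.
      - apply Rminus_le_0.
        match goal with |- 0 <= ?e =>
          replace e with
          ((4 * x ^ 4 + 8 * x ^ 3 * y + 14 * x ^ 3 + 3 * x ^ 2 * y ^ 2
            + 12 * x ^ 2 * y + 11 * x ^ 2 + x * y ^ 2 + 2 * x * y + x)
           / ((y + 1) * (y + x + 1) * (y + x + 2)
              * (y + 2 * x + 1) * (y + 2 * x + 2)))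
          by (field; repeat split; lra)
        end.
        apply Rdiv_le_0_compat; [nonneg|].
        repeat apply Rmult_lt_0_compat; lra. }
    lra.
Qed.

(** Replacing each [half_harmonic] by [harmonic] plus [defect] leaves twice a
second difference of [harmonic], and differences of values of [defect]. *)
Lemma dlog_weight_bound n k :
  0 <= dlog_weight n k <= 4 / (INR n + 1) + 4 / (INR k + 1)
    + 2 * (INR n ^ 2 / ((INR k + 1) * (INR k + INR n + 1))).
Proof.
  pose proof (harmonic_second_difference k n).
  pose proof (defect_close k n).
  pose proof (defect_close n k) as h; rewrite (Nat.add_comm n k) in h.
  unfold defect, dlog_weight, Rdiv in *. lra.
Qed.

(** * Decay of the weight *)

(** The relative decrease of [(n + 1) * weight n k] in one step of [n]; for
$n \ll k$ it is about $n^2/k^2$, whence a row extends to $n \approx k^{2/3}$. *)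
Definition ratio_drop (x y : R) : R := x ^ 2 / ((y + 2 * x + 1) * (y + 2 * x + 2)).

(** With $X$ the denominator of [ratio_drop], the arithmetic-geometric mean
inequality reduces the three linear factors and the cube in the numerator of
[ratio_n] to $A^3$, where $A \le X - x^2$; and $(x+2)(x+1/2)^3 \le (x+1)^4$
absorbs the factors that depend on $x$ alone. *)
Lemma ratio_n_le x y : 0 <= x -> 0 <= y ->
  (x + 2) * ratio_n x y <= (1 - ratio_drop x y) * (x + 1).
Proof.
  intros hx hy. unfold ratio_n, ratio_drop.
  set (X := (y + 2 * x + 1) * (y + 2 * x + 2)).
  assert (hX : 0 < X) by (apply Rmult_lt_0_compat; lra).
  set (A := (y + 3 * x + 2) * (y + x + / 2)).
  assert (hA0 : 0 <= A) by (apply Rmult_le_pos; lra).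
  assert (hA : A <= X - x ^ 2) by (unfold A, X; nra).
  assert (hA3 : A ^ 3 <= (X - x ^ 2) * X ^ 2).
  { replace (A ^ 3) with (A * A ^ 2) by ring.
    apply Rmult_le_compat; [lra|nra|lra|]. apply pow_incr. nra. }
  assert (h1 : (y + 3 * x + 1) * (y + 3 * x + 2) * (y + 3 * x + 3)
    * (y + x + / 2) ^ 3 <= A ^ 3).
  { unfold A. rewrite Rpow_mult_distr.
    apply Rmult_le_compat_r; [nonneg|].
    apply Rminus_le_0; ring_simplify; nonneg. }
  assert (h2 : (x + 2) * (x + / 2) ^ 3 <= (x + 1) ^ 4)
    by (apply Rminus_le_0; field_simplify; nonneg).
  assert (hx3 : 0 < (x + 1) ^ 3) by (apply pow_lt; lra).
  assert (hX3 : 0 < X ^ 3) by (apply pow_lt; lra).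
  replace ((x + 2) * _) with
    (((y + 3 * x + 1) * (y + 3 * x + 2) * (y + 3 * x + 3) * (y + x + / 2) ^ 3)
     * ((x + 2) * (x + / 2) ^ 3) / ((x + 1) ^ 3 * X ^ 3))
    by (unfold X; field; repeat split; lra).
  replace ((1 - x ^ 2 / X) * (x + 1)) with
    (((X - x ^ 2) * X ^ 2) * (x + 1) ^ 4 / ((x + 1) ^ 3 * X ^ 3))
    by (field; split; lra).
  apply Rmult_le_compat_r;
    [left; apply Rinv_0_lt_compat, Rmult_lt_0_compat; assumption|].
  apply Rmult_le_compat; [nonneg|nonneg|lra|exact h2].
Qed.

Lemma ratio_drop_bounds x y : 0 <= x -> 0 <= y -> 0 <= ratio_drop x y < 1.
Proof.
  intros hx hy. unfold ratio_drop.
  assert (0 < (y + 2 * x + 1) * (y + 2 * x + 2))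
    by (apply Rmult_lt_0_compat; lra).
  split; [apply Rdiv_le_0_compat; nonneg|].
  apply Rlt_div_l; [assumption|nra].
Qed.

Lemma weight_S_n_le n k :
  (INR n + 2) * weight (S n) k
    <= (1 - ratio_drop (INR n) (INR k)) * ((INR n + 1) * weight n k).
Proof.
  rewrite weight_S_n.
  pose proof (weight_pos n k).
  pose proof (ratio_n_le (INR n) (INR k) (pos_INR n) (pos_INR k)).
  nra.
Qed.

Lemma weight_decr n k : weight (S n) k <= weight n k.
Proof.
  pose proof (weight_S_n_le n k). pose proof (weight_pos n k).
  pose proof (weight_pos (S n) k). pose proof (pos_INR n).
  pose proof (ratio_drop_bounds (INR n) (INR k) (pos_INR n) (pos_INR k)).
  assert ((1 - ratio_drop (INR n) (INR k)) * ((INR n + 1) * weight n k)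
    <= 1 * ((INR n + 1) * weight n k)) by (apply Rmult_le_compat_r; nra).
  nra.
Qed.

Lemma weight_le_first n k : weight n k <= weight 0 k.
Proof.
  induction n as [|n IH]; [lra|]. pose proof (weight_decr n k); lra.
Qed.

(** For $k < n$ the denominator of [ratio_drop] is at most $20 n^2$. *)
Lemma weight_geometric n k :
  (k < n)%nat -> weight (S n) k <= 19 / 20 * weight n k.
Proof.
  intros h; apply lt_INR in h.
  pose proof (weight_S_n_le n k) as hs. pose proof (weight_pos n k) as hw.
  pose proof (pos_INR n) as hx. pose proof (pos_INR k) as hy.
  pose proof (weight_pos (S n) k).
  assert (hd : / 20 <= ratio_drop (INR n) (INR k)).
  { assert (1 <= INR n).
    { apply (le_INR 1). destruct n; [simpl in h; lra|lia]. }
    unfold ratio_drop. apply Rle_div_r; [apply Rmult_lt_0_compat; lra|nra]. }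
  assert ((1 - ratio_drop (INR n) (INR k)) * ((INR n + 1) * weight n k)
    <= 19 / 20 * ((INR n + 1) * weight n k)) by (apply Rmult_le_compat_r; nra).
  nra.
Qed.

Lemma eventually_decr_bounded (N : nat) (a : nat -> R) :
  (forall n, (N <= n)%nat -> a (S n) <= a n) -> exists B, forall n, a n <= B.
Proof.
  revert a; induction N as [|N IH]; intros a h.
  - exists (a O); intros n; induction n as [|n IHn]; [lra|].
    specialize (h n ltac:(lia)); lra.
  - destruct (IH (fun n => a (S n))) as [B hB].
    { intros n hn; apply h; lia. }
    exists (Rmax (a O) B); intros [|n]; [apply Rmax_l|].
    eapply Rle_trans; [apply hB|apply Rmax_r].
Qed.

(** Induction on [p]: multiplying by [n + 1] only replaces the ratio [r] by
$(1+r)/2$, from some index on. *)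
Lemma geometric_beats_power (p N : nat) (r : R) (a : nat -> R) :
  0 < r < 1 -> (forall n, 0 <= a n) ->
  (forall n, (N <= n)%nat -> a (S n) <= r * a n) ->
  exists B, forall n, (INR n + 1) ^ p * a n <= B.
Proof.
  revert N r a; induction p as [|p IH]; intros N r a hr ha hs.
  - destruct (eventually_decr_bounded N a) as [B hB].
    { intros n hn. specialize (hs n hn); specialize (ha n); nra. }
    exists B; intros n; simpl; rewrite Rmult_1_l; apply hB.
  - destruct (nfloor_ex (2 * r / (1 - r))) as [M [_ hM]].
    { apply Rdiv_le_0_compat; lra. }
    destruct (IH (N + M)%nat ((1 + r) / 2) (fun n => (INR n + 1) * a n))
      as [B hB].
    + lra.
    + intros n; pose proof (pos_INR n); specialize (ha n); nra.
    + intros n hn. rewrite S_INR.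
      specialize (hs n ltac:(lia)); specialize (ha n).
      assert (hx : INR M <= INR n) by (apply le_INR; lia).
      pose proof (pos_INR n).
      assert (hr2 : (INR n + 1 + 1) * r <= (1 + r) / 2 * (INR n + 1)).
      { apply (Rmult_lt_compat_r (1 - r)) in hM; [|lra].
        unfold Rdiv in hM; rewrite Rmult_assoc, Rinv_l in hM by lra. nra. }
      nra.
    + exists B; intros n. simpl. specialize (hB n); simpl in hB.
      rewrite (Rmult_comm (INR n + 1)), Rmult_assoc. exact hB.
Qed.

Lemma weight_decay p k : exists B, forall n, (INR n + 1) ^ p * weight n k <= B.
Proof.
  apply (geometric_beats_power p (S k) (19 / 20)).
  - lra.
  - intros n; left; apply weight_pos.
  - intros n hn; apply weight_geometric; lia.
Qed.

(** [weight 0 k] is the square of $\binom{2k}{k}/4^k$. *)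
Lemma weight_first_le k : weight 0 k <= / (INR k + 1).
Proof.
  induction k as [|k IH].
  - unfold weight; simpl; lra.
  - rewrite weight_S_k, S_INR; unfold ratio_k; simpl (INR 0).
    pose proof (pos_INR k). pose proof (weight_pos 0 k).
    set (y := INR k) in *.
    replace ((y + 3 * 0 + 1) * (y + 0 + / 2) ^ 3
        / ((y + / 2) * (y + 2 * 0 + 1) ^ 3))
      with (((y + / 2) / (y + 1)) ^ 2) by (field; split; lra).
    apply Rle_trans with (/ (y + 1) * ((y + / 2) / (y + 1)) ^ 2).
    + apply Rmult_le_compat_r; [apply pow2_ge_0|exact IH].
    + apply Rminus_le_0.
      replace (/ (y + 1 + 1) - / (y + 1) * ((y + / 2) / (y + 1)) ^ 2) with
        ((3 / 4 * y + / 2) / ((y + 1) ^ 3 * (y + 2))) by (field; lra).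
      apply Rdiv_le_0_compat; [lra|].
      apply Rmult_lt_0_compat; [apply pow_lt|]; lra.
Qed.

(** * Row sums of the undifferentiated pair *)

(** A simple sequence of the same order as [G]. *)
Definition mass (n k : nat) : R := (INR n + 1) ^ 2 * weight n k.

Lemma mass_nonneg n k : 0 <= mass n k.
Proof.
  unfold mass. pose proof (weight_pos n k). nonneg.
Qed.

Lemma G_bounds n k : mass n (S k) <= G n (S k) <= 48 * mass n (S k).
Proof.
  unfold G, mass. pose proof (weight_pos n (S k)).
  assert (1 <= INR (S k)) by (rewrite S_INR; pose proof (pos_INR k); lra).
  pose proof (Grat_bounds (INR n) (INR (S k)) (pos_INR n) H0). split; nra.
Qed.

Lemma F_nonneg n k : 0 <= F n k.
Proof.
  destruct n as [|n]; [rewrite F_0; lra|].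
  unfold F, Frat. pose proof (weight_pos (S n) k). pose proof (pos_INR k).
  assert (0 < INR (S n)) by (apply lt_0_INR; lia).
  apply Rmult_le_pos; [lra|]. apply Rdiv_le_0_compat; [nonneg|].
  apply Rmult_lt_0_compat; lra.
Qed.

Lemma sum_G_S M k :
  sum_f_R0 (fun n => G n (S (S k))) M
  = sum_f_R0 (fun n => G n (S k)) M - F (S M) (S k).
Proof.
  induction M as [|M IH]; simpl.
  - pose proof (WZ_pair 0 (S k) ltac:(lia)) as h. rewrite F_0 in h. lra.
  - rewrite IH. pose proof (WZ_pair (S M) (S k) ltac:(lia)) as h. lra.
Qed.

(** Each passage to the next row loses the boundary term $F \ge 0$. *)
Lemma sum_G_decr M k :
  sum_f_R0 (fun n => G n (S k)) M <= sum_f_R0 (fun n => G n 1) M.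
Proof.
  induction k as [|k IH]; [lra|].
  rewrite sum_G_S. pose proof (F_nonneg (S M) (S k)). lra.
Qed.

Lemma sum_inv_square_le M :
  sum_f_R0 (fun n => / (INR n + 1) ^ 2) M <= 2 - / (INR M + 1).
Proof.
  induction M as [|M IH]; [simpl; lra|].
  rewrite tech5, S_INR. pose proof (pos_INR M).
  assert (/ (INR M + 1 + 1) ^ 2 <= / (INR M + 1) - / (INR M + 1 + 1)); [|lra].
  replace (/ (INR M + 1) - / (INR M + 1 + 1))
    with (/ ((INR M + 1) * (INR M + 2))) by (field; lra).
  apply Rinv_le_contravar; [apply Rmult_lt_0_compat; lra|nra].
Qed.

Lemma sum_inv_square_le_2 M : sum_f_R0 (fun n => / (INR n + 1) ^ 2) M <= 2.
Proof.
  pose proof (sum_inv_square_le M). pose proof (pos_INR M).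
  assert (0 < / (INR M + 1)) by (apply Rinv_0_lt_compat; lra). lra.
Qed.

Lemma sum_mass_bounded :
  exists C, forall k M, sum_f_R0 (fun n => mass n (S k)) M <= C.
Proof.
  destruct (weight_decay 4 1) as [B hB].
  exists (48 * B * 2); intros k M.
  assert (hB0 : 0 <= B).
  { eapply Rle_trans; [|apply (hB O)]. pose proof (weight_pos 0 1).
    nonneg. }
  apply Rle_trans with (sum_f_R0 (fun n => G n (S k)) M).
  { apply sum_Rle; intros n _; apply G_bounds. }
  eapply Rle_trans; [apply sum_G_decr|].
  apply Rle_trans with (48 * B * sum_f_R0 (fun n => / (INR n + 1) ^ 2) M).
  - rewrite scal_sum; apply sum_Rle; intros n _.
    eapply Rle_trans; [apply G_bounds|]. unfold mass.
    specialize (hB n). pose proof (pos_INR n).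
    assert (hsq : 0 < (INR n + 1) ^ 2) by (apply pow_lt; lra).
    apply Rle_trans with (48 * (B / (INR n + 1) ^ 2)); [|right; field; lra].
    apply Rmult_le_compat_l; [lra|]. apply (Rle_div_r _ _ _ hsq).
    eapply Rle_trans; [right|exact hB]; ring.
  - apply Rmult_le_compat_l; [lra|apply sum_inv_square_le_2].
Qed.

(** * Smallness of the differentiated rows *)

(** Summation by parts. With $T_n = (n+1) w_0(n,k)$ and
$v_n = (n+1)(k+2n+1)/(k+1)$, the $n$-th term on the left is
$v_n T_n$ times [ratio_drop], hence at most $v_n (T_n - T_{n+1})$; on the right
stand $v_0 T_0$ and the increments of $v$ times $T_n$. *)
Lemma sum_mass_telescope k M :
  sum_f_R0 (fun n => mass n k * (INR n ^ 2
     / ((INR k + 1) * (INR k + 2 * INR n + 2)))) M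
  <= weight 0 k
     + sum_f_R0 (fun n => mass n k / (INR n + 1) + 4 * mass n k / (INR k + 1)) M.
Proof.
  set (v := fun n => (INR n + 1) * (INR k + 2 * INR n + 1) / (INR k + 1)).
  assert (hy : 0 <= INR k) by apply pos_INR.
  assert (hv : forall n, 0 <= v n).
  { intros n; pose proof (pos_INR n). unfold v.
    apply Rdiv_le_0_compat; [nonneg|lra]. }
  assert (step : forall n,
    mass n k * (INR n ^ 2 / ((INR k + 1) * (INR k + 2 * INR n + 2)))
    + v (S n) * ((INR (S n) + 1) * weight (S n) k)
    <= v n * ((INR n + 1) * weight n k)
       + (mass n k / (INR n + 1) + 4 * mass n k / (INR k + 1))).
  { intros n. pose proof (weight_S_n_le n k) as hs.
    pose proof (weight_pos n k) as hW. pose proof (pos_INR n) as hx.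
    replace (INR (S n) + 1) with (INR n + 2) by (rewrite S_INR; ring).
    assert (hinc : v (S n) - v n <= 1 + 4 * (INR n + 1) / (INR k + 1)).
    { unfold v; rewrite S_INR. apply Rminus_le_0.
      match goal with |- 0 <= ?e => replace e with 0 by (field; lra) end; lra. }
    assert (hinc0 : 0 <= v (S n) - v n).
    { unfold v; rewrite S_INR.
      match goal with |- 0 <= ?e =>
        replace e with ((INR k + 4 * INR n + 5) / (INR k + 1)) by (field; lra)
      end. apply Rdiv_le_0_compat; lra. }
    assert (hd : mass n k * (INR n ^ 2 / ((INR k + 1) * (INR k + 2 * INR n + 2)))
      = v n * (ratio_drop (INR n) (INR k) * ((INR n + 1) * weight n k))).
    { unfold mass, v, ratio_drop. field; lra. }
    assert (hm : mass n k / (INR n + 1) + 4 * mass n k / (INR k + 1)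
      = (1 + 4 * (INR n + 1) / (INR k + 1)) * ((INR n + 1) * weight n k)).
    { unfold mass. field; lra. }
    rewrite hd, hm.
    pose proof (ratio_drop_bounds (INR n) (INR k) hx hy).
    set (T := (INR n + 1) * weight n k) in *.
    assert (hT : 0 <= T) by (unfold T; nonneg).
    set (T' := (INR n + 2) * weight (S n) k) in *.
    set (d := ratio_drop (INR n) (INR k)) in *.
    specialize (hv n).
    assert (T' <= T) by nra.
    assert (v n * T' <= v n * ((1 - d) * T)) by (apply Rmult_le_compat_l; lra).
    assert ((v (S n) - v n) * T' <= (v (S n) - v n) * T)
      by (apply Rmult_le_compat_l; lra).
    assert ((v (S n) - v n) * T <= (1 + 4 * (INR n + 1) / (INR k + 1)) * T)
      by (apply Rmult_le_compat_r; lra).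
    nra. }
  assert (hfin : 0 <= v (S M) * ((INR (S M) + 1) * weight (S M) k)).
  { apply Rmult_le_pos; [apply hv|]. pose proof (weight_pos (S M) k).
    nonneg. }
  assert (h0 : v O * ((INR 0 + 1) * weight 0 k) = weight 0 k)
    by (unfold v; simpl (INR 0); field; lra).
  rewrite <- h0.
  enough (h : sum_f_R0 (fun n => mass n k * (INR n ^ 2
      / ((INR k + 1) * (INR k + 2 * INR n + 2)))) M
    + v (S M) * ((INR (S M) + 1) * weight (S M) k)
    <= v O * ((INR 0 + 1) * weight 0 k)
     + sum_f_R0 (fun n => mass n k / (INR n + 1) + 4 * mass n k / (INR k + 1)) M)
    by lra.
  clear hfin h0; induction M as [|M IH]; [exact (step O)|].
  rewrite !tech5. pose proof (step (S M)). lra.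
Qed.

(** For $n \ge N$ the first term on the right suffices, and for $n < N$ the
second, which is summable in [n] and small when [k] is large compared with
[N]. *)
Lemma mass_div_le N n k :
  mass n k / (INR n + 1)
  <= mass n k / (INR N + 1) + (INR N + 1) ^ 3 * weight 0 k * / (INR n + 1) ^ 2.
Proof.
  pose proof (pos_INR n). pose proof (pos_INR N). pose proof (mass_nonneg n k).
  pose proof (weight_pos 0 k).
  assert (hsq : 0 < / (INR n + 1) ^ 2)
    by (apply Rinv_0_lt_compat, pow_lt; lra).
  destruct (Rle_lt_dec (INR N) (INR n)).
  - assert (mass n k / (INR n + 1) <= mass n k / (INR N + 1)).
    { apply Rmult_le_compat_l; [assumption|]. apply Rinv_le_contravar; lra. }
    assert (0 <= (INR N + 1) ^ 3 * weight 0 k * / (INR n + 1) ^ 2) by nonneg.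
    lra.
  - assert (0 <= mass n k / (INR N + 1)) by (apply Rdiv_le_0_compat; lra).
    enough (mass n k / (INR n + 1)
      <= (INR N + 1) ^ 3 * weight 0 k * / (INR n + 1) ^ 2) by lra.
    unfold mass.
    replace ((INR n + 1) ^ 2 * weight n k / (INR n + 1))
      with ((INR n + 1) ^ 3 * weight n k * / (INR n + 1) ^ 2) by (field; lra).
    apply Rmult_le_compat_r; [lra|].
    apply Rmult_le_compat; [nonneg|left; apply weight_pos| |apply weight_le_first].
    apply pow_incr; lra.
Qed.

Lemma dG_bound n k :
  Rabs (dG n (S k)) <= 480 * (mass n (S k) / (INR n + 1))
    + 192 * (mass n (S k) / (INR (S k) + 1))
    + 192 * (mass n (S k) * (INR n ^ 2
        / ((INR (S k) + 1) * (INR (S k) + 2 * INR n + 2)))).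
Proof.
  assert (hk : 1 <= INR (S k)) by (rewrite S_INR; pose proof (pos_INR k); lra).
  pose proof (G_bounds n k) as [_ hG].
  pose proof (dlog_weight_bound n (S k)) as [hl0 hl].
  pose proof (pos_INR n) as hx. pose proof (weight_pos n (S k)) as hw.
  pose proof (mass_nonneg n (S k)) as hm.
  pose proof (Grat_bounds _ _ hx hk) as [hg _].
  pose proof (dGrat_bound (INR n) (INR (S k)) hx ltac:(lra) ltac:(lra)) as hd.
  set (x := INR n) in *; set (y := INR (S k)) in *.
  assert (hg0 : 0 <= Grat x y) by (eapply Rle_trans; [|exact hg]; nonneg).
  assert (hq : x ^ 2 / ((y + 1) * (y + x + 1))
    <= 2 * (x ^ 2 / ((y + 1) * (y + 2 * x + 2)))).
  { replace (2 * (x ^ 2 / ((y + 1) * (y + 2 * x + 2))))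
      with (x ^ 2 * / ((y + 1) * ((y + 2 * x + 2) / 2))) by (field; lra).
    apply Rmult_le_compat_l; [nonneg|].
    apply Rinv_le_contravar; [apply Rmult_lt_0_compat; lra|].
    apply Rmult_le_compat_l; lra. }
  set (q := x ^ 2 / ((y + 1) * (y + 2 * x + 2))) in *.
  set (l := dlog_weight n (S k)) in *.
  apply Rle_trans with (G n (S k) * (l + 6 / (x + 1))).
  { unfold dG, G; fold x y l.
    rewrite Rabs_mult, (Rabs_pos_eq (weight _ _)), Rmult_assoc by lra.
    apply Rmult_le_compat_l; [lra|].
    eapply Rle_trans; [apply Rabs_triang|].
    rewrite Rabs_mult, (Rabs_pos_eq l), (Rabs_pos_eq (Grat x y)) by lra. lra. }
  assert (h6 : 0 <= 6 / (x + 1)) by (apply Rdiv_le_0_compat; lra).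
  apply Rle_trans with
    (48 * mass n (S k) * (4 / (x + 1) + 4 / (y + 1) + 2 * (2 * q) + 6 / (x + 1))).
  - apply Rmult_le_compat; [|lra|exact hG|lra].
    unfold G; fold x y; nra.
  - right; field; split; lra.
Qed.

(** The row index of order $N^4$ makes $N^3$ [weight 0 k] of order at most
$1/N$, as [mass_div_le] requires. *)
Lemma row_sum_small :
  exists C, forall N M,
    sum_f_R0 (fun n => Rabs (dG n (S ((N + 1) ^ 4)))) M <= C / (INR N + 1).
Proof.
  destruct sum_mass_bounded as [C0 hC].
  exists (1536 + 1632 * C0); intros N M.
  set (k := ((N + 1) ^ 4)%nat).
  assert (hN : 0 <= INR N) by apply pos_INR.
  assert (hk : INR k = (INR N + 1) ^ 4)
    by (unfold k; rewrite pow_INR, plus_INR; reflexivity).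
  set (A := sum_f_R0 (fun n => mass n (S k)) M).
  assert (hA : A <= C0) by apply hC.
  assert (hA0 : 0 <= A) by (apply cond_pos_sum; intros n; apply mass_nonneg).
  set (Q := sum_f_R0 (fun n => mass n (S k) / (INR n + 1)) M).
  assert (hw0 : weight 0 (S k) <= / (INR N + 1) ^ 4).
  { eapply Rle_trans; [apply weight_first_le|]. rewrite S_INR, hk.
    apply Rinv_le_contravar; [apply pow_lt|]; lra. }
  pose proof (weight_pos 0 (S k)) as hw.
  assert (h4 : 1 <= (INR N + 1) ^ 3) by (apply pow_R1_Rle; lra).
  assert (hw3 : (INR N + 1) ^ 3 * weight 0 (S k) <= / (INR N + 1)).
  { apply Rle_trans with ((INR N + 1) ^ 3 * / (INR N + 1) ^ 4);
      [apply Rmult_le_compat_l; lra|right; field; lra]. }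
  assert (hw1 : weight 0 (S k) <= / (INR N + 1)) by nra.
  assert (hk1 : / (INR (S k) + 1) <= / (INR N + 1)).
  { rewrite S_INR, hk. apply Rinv_le_contravar; [lra|].
    replace ((INR N + 1) ^ 4) with ((INR N + 1) * (INR N + 1) ^ 3) by ring. nra. }
  set (v := / (INR N + 1)) in *.
  assert (hv : 0 < v) by (apply Rinv_0_lt_compat; lra).
  assert (hQ : Q <= C0 * v + 2 * v).
  { apply Rle_trans with (v * A + (INR N + 1) ^ 3 * weight 0 (S k)
      * sum_f_R0 (fun n => / (INR n + 1) ^ 2) M).
    - unfold Q, A. rewrite !scal_sum, <- plus_sum.
      apply sum_Rle; intros n _.
      eapply Rle_trans; [apply (mass_div_le N)|]. unfold v, Rdiv; lra.
    - apply Rplus_le_compat; [rewrite Rmult_comm; apply Rmult_le_compat_r; lra|].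
      rewrite (Rmult_comm 2).
      apply Rmult_le_compat; [nonneg|apply cond_pos_sum|lra
        |apply sum_inv_square_le_2].
      intros n; left; apply Rinv_0_lt_compat, pow_lt.
      pose proof (pos_INR n); lra. }
  assert (hK : A * / (INR (S k) + 1) <= C0 * v).
  { apply Rmult_le_compat; [lra| |lra|lra].
    left; apply Rinv_0_lt_compat; pose proof (pos_INR (S k)); lra. }
  pose proof (sum_mass_telescope (S k) M) as ht.
  assert (e : sum_f_R0 (fun n => mass n (S k) / (INR n + 1)
      + 4 * mass n (S k) / (INR (S k) + 1)) M
      = Q + 4 * (A * / (INR (S k) + 1))).
  { unfold Q, A. rewrite plus_sum, (Rmult_comm _ (/ _)), <- Rmult_assoc, scal_sum.
    f_equal. apply sum_eq; intros n _; unfold Rdiv; ring. }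
  rewrite e in ht.
  eapply Rle_trans; [apply sum_Rle; intros n _; apply dG_bound|].
  set (T := sum_f_R0 (fun n => mass n (S k) * (INR n ^ 2
     / ((INR (S k) + 1) * (INR (S k) + 2 * INR n + 2)))) M) in ht.
  apply Rle_trans with (480 * Q + 192 * / (INR (S k) + 1) * A + 192 * T).
  { right; unfold Q, A, T. rewrite !scal_sum, <- !plus_sum.
    apply sum_eq; intros n _; unfold Rdiv; ring. }
  unfold Rdiv; fold v. nra.
Qed.

(** * Transport from row 0 to infinity *)

Lemma Frat_bounds x y : 1 <= x -> 0 <= y -> 0 <= Frat x y <= 48 * x ^ 3.
Proof.
  intros hx hy. unfold Frat.
  assert (hD : 0 < (y + 3 * x) * (y + / 2)) by (apply Rmult_lt_0_compat; lra).
  split; [apply Rdiv_le_0_compat; [nonneg|assumption]|].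
  apply (Rle_div_l _ _ _ hD).
  replace (48 * x ^ 3 * ((y + 3 * x) * (y + / 2)))
    with (16 * x ^ 3 * (3 * ((y + 3 * x) * (y + / 2)))) by ring.
  apply Rmult_le_compat_l; [nonneg|]. nra.
Qed.

Lemma dFrat_bound x y : 1 <= x -> 0 <= y -> Rabs (dFrat x y) <= 224 * x ^ 3.
Proof.
  intros hx hy. pose proof (Frat_bounds x y hx hy) as [hF0 hF].
  assert (hx3 : 0 <= x ^ 3) by nonneg.
  replace (dFrat x y)
    with (- (2 * (Frat x y / x) + 32 * x ^ 3 * / (y + / 2) ^ 2))
    by (unfold Frat, dFrat; field; repeat split; lra).
  assert (h1 : 0 <= Frat x y / x <= Frat x y).
  { split; [apply Rdiv_le_0_compat; lra|].
    apply Rle_div_l; [lra|nra]. }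
  assert (h2 : 0 <= / (y + / 2) ^ 2 <= 4).
  { split; [left; apply Rinv_0_lt_compat, pow_lt; lra|].
    replace 4 with (/ (/ 2) ^ 2) by field.
    apply Rinv_le_contravar; [apply pow_lt; lra|apply pow_incr; lra]. }
  rewrite Rabs_Ropp, Rabs_pos_eq; nra.
Qed.

Lemma is_lim_seq_inv_succ : is_lim_seq (fun n => / (INR n + 1)) 0.
Proof.
  apply (is_lim_seq_ext (fun n => / INR (S n))).
  { intros n; rewrite S_INR; reflexivity. }
  apply (is_lim_seq_incr_1 (fun n => / INR n)).
  exact (is_lim_seq_inv _ _ is_lim_seq_INR ltac:(discriminate)).
Qed.

Lemma dF_vanishes k : is_lim_seq (fun n => dF (S n) k) 0.
Proof.
  destruct (weight_decay 5 k) as [B hB].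
  apply is_lim_seq_abs_0.
  apply is_lim_seq_le_le with (fun _ => 0) (fun n => 704 * B * / (INR n + 1)).
  - intros n; split; [apply Rabs_pos|].
    specialize (hB (S n)). rewrite !S_INR in hB.
    pose proof (weight_pos (S n) k) as hw. pose proof (pos_INR n).
    pose proof (pos_INR k) as hy.
    assert (hx : 1 <= INR (S n)) by (rewrite S_INR; lra).
    pose proof (dlog_weight_bound (S n) k) as [hl0 hl].
    pose proof (Frat_bounds _ _ hx hy). pose proof (dFrat_bound _ _ hx hy).
    set (x := INR (S n)) in *. set (y := INR k) in *.
    set (l := dlog_weight (S n) k) in *.
    assert (hl' : l <= 10 * x).
    { assert (4 / (x + 1) <= 4) by (apply Rle_div_l; lra).
      assert (4 / (y + 1) <= 4) by (apply Rle_div_l; lra).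
      assert (x ^ 2 / ((y + 1) * (y + x + 1)) <= x).
      { apply Rle_div_l; [apply Rmult_lt_0_compat; lra|nra]. }
      lra. }
    replace (INR n + 1) with x in * by (unfold x; rewrite S_INR; ring).
    assert (hd : Rabs (dF (S n) k) <= 704 * x ^ 4 * weight (S n) k).
    { unfold dF; fold x y l.
      rewrite Rabs_mult, (Rabs_pos_eq (weight _ _)), Rmult_comm by lra.
      apply Rmult_le_compat_r; [lra|].
      eapply Rle_trans; [apply Rabs_triang|].
      rewrite Rabs_mult, (Rabs_pos_eq l), (Rabs_pos_eq (Frat x y)) by lra.
      assert (Frat x y * l <= 48 * x ^ 3 * (10 * x))
        by (apply Rmult_le_compat; lra).
      assert (0 <= x ^ 3) by nonneg. simpl in *; nra. }
    eapply Rle_trans; [exact hd|].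
    apply (Rle_div_r _ _ x); [lra|].
    assert (x ^ 5 <= (x + 1) ^ 5) by (apply pow_incr; lra).
    assert (x ^ 5 * weight (S n) k <= (x + 1) ^ 5 * weight (S n) k)
      by (apply Rmult_le_compat_r; lra).
    simpl in *; nra.
  - apply is_lim_seq_const.
  - evar_last; [apply is_lim_seq_scal_l, is_lim_seq_inv_succ|].
    simpl; f_equal; ring.
Qed.

Lemma sum_dG_row k M :
  sum_f_R0 (fun n => dG n (S k)) M
  = 2 / 3 * sum_f_R0 summand M - sum_f_R0 (fun j => dF (S M) j) k.
Proof.
  assert (h0 : sum_f_R0 (fun n => dG n 1) M
    = 2 / 3 * sum_f_R0 summand M - dF (S M) 0).
  { induction M as [|M IH]; simpl.
    - pose proof (row_0_to_1 0) as h. rewrite dF_0 in h. lra.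
    - rewrite IH. pose proof (row_0_to_1 (S M)). lra. }
  induction k as [|k IH]; [exact h0|].
  rewrite tech5.
  enough (sum_f_R0 (fun n => dG n (S (S k))) M
    = sum_f_R0 (fun n => dG n (S k)) M - dF (S M) (S k)) by lra.
  clear; induction M as [|M IH]; simpl.
  - pose proof (WZ_pair_deriv 0 (S k) ltac:(lia)) as h. rewrite dF_0 in h. lra.
  - rewrite IH. pose proof (WZ_pair_deriv (S M) (S k) ltac:(lia)). lra.
Qed.

Lemma boundary_vanishes k :
  is_lim_seq (fun M => sum_f_R0 (fun j => dF (S M) j) k) 0.
Proof.
  induction k as [|k IH]; [apply dF_vanishes|].
  simpl. evar_last; [apply is_lim_seq_plus'; [exact IH|apply dF_vanishes]|].
  f_equal; ring.
Qed.

(** A row with small sums is chosen first; then the boundary terms between it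
and row $0$ are made small by summing far enough. *)
Lemma partial_sums_vanish : is_lim_seq (sum_f_R0 summand) 0.
Proof.
  apply is_lim_seq_spec; intros eps; simpl.
  destruct row_sum_small as [C hC].
  destruct (nfloor_ex (Rmax 0 (8 * C / eps))) as [N [_ hN]]; [apply Rmax_l|].
  set (k := ((N + 1) ^ 4)%nat) in *.
  pose proof (boundary_vanishes k) as hb. apply is_lim_seq_spec in hb.
  destruct (hb (pos_div_2 eps)) as [M0 hM0].
  exists M0; intros M hM. specialize (hM0 M hM). simpl in hM0.
  specialize (hC N M); fold k in hC.
  pose proof (sum_dG_row k M) as hs.
  pose proof (sum_f_R0_triangle (fun n => dG n (S k)) M) as ht.
  assert (hCe : C / (INR N + 1) <= eps / 8).
  { pose proof (Rmax_r 0 (8 * C / eps)). pose proof (pos_INR N).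
    pose proof (cond_pos eps).
    assert (h4 : 8 * C / eps < INR N + 1) by lra.
    apply Rlt_div_l in h4; [|assumption].
    apply Rle_div_l; [lra|]. lra. }
  rewrite Rminus_0_r in *.
  apply Rabs_def2 in hM0.
  apply (Rle_trans _ _ _ ht) in hC.
  apply (Rle_trans _ _ _ hC), Rabs_le_between in hCe.
  apply Rabs_def1; lra.
Qed.

Theorem theorem1p9 :
  is_series
    (fun k : nat =>
       binom (2 * k) k ^ 4 * binom (3 * k) k / 2 ^ (12 * k) *
       ((74 * INR k ^ 2 + 27 * INR k + 3) * harmonic (2 * k) - 17 * INR k - 3))
    0.
Proof.
  change (is_lim_seq (sum_n summand) 0).
  apply (is_lim_seq_ext (sum_f_R0 summand)).
  - intros n; symmetry; apply sum_n_Reals.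
  - exact partial_sums_vanish.
Qed.
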